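(* Let $k \ge 0$ be an integer and let $G$ be a graph on $n$ vertices with average degree $d$ and minimum degree $\delta$. Then $$\alpha_{k-\mathrm{reg}}(G) \ge \frac{n}{(2d-2\delta+1)\,\chi_k(G)}.$$
   Context: Graphs are finite and simple. A $k$-independent set is a set of vertices whose induced subgraph has maximum degree at most $k$. The regular $k$-independence number $\alpha_{k-\mathrm{reg}}(G)$ is the maximum cardinality of a $k$-independent set of $G$ all of whose vertices have the same degree in $G$. The $k$-chromatic number $\chi_k(G)$ is the minimum number of colors needed to color the vertices of $G$ so that the subgraph induced by each color class has maximum degree at most $k$. *)

(* Defs.v *)
From mathcomp Require Import all_boot all_order all_algebra.

Set Implicit Arguments.
Unset Strict Implicit.
Unset Printing Implicit Defensive.

Record sgraph (T : finType) := SGraph {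
  adj :> rel T;
  adj_sym : symmetric adj;
  adj_irrefl : irreflexive adj }.

Section GraphParameters.

Variables (T : finType) (G : sgraph T).

Definition neighbors (v : T) : {set T} := [set w | G v w].

Definition degree (v : T) : nat := #|neighbors v|.

(* The neutral element #|T| exceeds every degree, so it matters only when T
   is empty. *)
Definition min_degree : nat := \big[minn/#|T|]_(v : T) degree v.

(* Equal to 0 when T is empty. *)
Definition avg_degree : rat :=
  ((\sum_(v : T) degree v)%N%:R / #|T|%:R)%R.

Definition induced_max_degree (S : {set T}) : nat :=
  \max_(v in S) #|neighbors v :&: S|.

Definition k_independent (k : nat) (S : {set T}) : bool :=
  induced_max_degree S <= k.

Definition same_degree (S : {set T}) : bool :=
  [forall u in S, forall v in S, degree u == degree v].

Definition alpha_reg (k : nat) : nat :=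
  \max_(S : {set T} | k_independent k S && same_degree S) #|S|.

(* Color classes may be empty: this is colorability with at most c colors. *)
Definition k_colorable (k c : nat) : bool :=
  [exists f : {ffun T -> 'I_c},
    forall i : 'I_c, k_independent k [set v | f v == i]].

Lemma k_colorable_exists (k : nat) : exists c, k_colorable k c.
Proof.
exists #|T|; apply/existsP; exists [ffun v => enum_rank v].
apply/forallP => i; apply/bigmax_leqP => v; rewrite inE ffunE => /eqP iv.
rewrite (_ : _ :&: _ = set0) ?cards0 //; apply/setP => w.
rewrite !inE ffunE -iv (inj_eq enum_rank_inj).
by case: eqP => [->|_]; rewrite ?adj_irrefl ?andbF.
Qed.

Definition chi (k : nat) : nat := ex_minn (k_colorable_exists k).

End GraphParameters.

(* Main.v *)
(* Intersecting the vertices of a fixed degree with the classes of an optimal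
   k-coloring gives n_j <= M := alpha_reg * chi for the number n_j of vertices
   of degree j.  Hence at most (deg v - delta) M vertices have degree less than
   deg v, at most M have degree equal to deg v, and counting ordered pairs of
   vertices by comparing their degrees yields
   n ^ 2 <= \sum_v (2 (deg v - delta) + 1) M = n (2 d - 2 delta + 1) M. *)
Require Import Defs.
From mathcomp Require Import all_boot all_order all_algebra.
From mathcomp Require Import ring.

Set Implicit Arguments.
Unset Strict Implicit.
Unset Printing Implicit Defensive.

Section FibreCounting.

Variables (T : finType) (f : T -> nat) (m M : nat).
Hypothesis fibre_le : forall j, #|[set x | f x == j]| <= M.
Hypothesis f_ge : forall x, m <= f x.

(** Such [x] take values from [m] to [j - 1], and each fibre has at most [M] points; if [j <= m],
    there are none, matching truncated subtraction. *)
Lemma card_lt_fibres j : #|[set x | f x < j]| <= (j - m) * M.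
Proof.
elim: j => [|j IHj].
  by rewrite (_ : [set x | _] = set0) ?cards0 //; apply/setP => x; rewrite !inE.
have [le_mj|lt_jm] := leqP m j; last first.
  rewrite (_ : [set x | _] = set0) ?cards0 //; apply/setP => x.
  by rewrite !inE ltnNge (leq_trans lt_jm (f_ge x)).
rewrite (_ : [set x | _] = [set x | f x == j] :|: [set x | f x < j]); last first.
  by apply/setP => x; rewrite !inE ltnS leq_eqVlt.
by rewrite (leq_trans (leq_card_setU _ _)) // subSn // mulSn leq_add.
Qed.

Lemma sqr_card_le : #|T| ^ 2 <= \sum_x ((f x - m).*2.+1 * M).
Proof.
have cardE (P : pred T) : #|[set y | P y]| = \sum_y P y.
  by rewrite -sum1dep_card big_mkcond.
have lt_sum : \sum_x #|[set y | f y < f x]| = \sum_x #|[set y | f x < f y]|.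
  under eq_bigr do rewrite cardE.
  by rewrite exchange_big; apply: eq_bigr => x _; rewrite cardE.
have -> : #|T| ^ 2 =
    \sum_x (#|[set y | f y == f x]| + (#|[set y | f y < f x]|).*2).
  under [RHS]eq_bigr do rewrite -addnn.
  (* Only one of the two equal sums is swapped, so that for each [x] the cases [=], [<] and [>]
     partition [T]. *)
  rewrite !big_split /= {2}lt_sum -!big_split -mulnn -sum_nat_const.
  apply: eq_bigr => x _; rewrite !cardE -sum1_card -!big_split.
  by apply: eq_bigr => y _ /=; case: ltngtP.
apply: leq_sum => x _.
by rewrite mulSn -doubleMl leq_add // leq_double card_lt_fibres.
Qed.

End FibreCounting.

Section GraphBounds.

Variables (T : finType) (G : sgraph T).

Lemma min_degree_le v : min_degree G <= degree G v.
Proof.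
rewrite /min_degree; have := mem_index_enum v.
elim: (index_enum T) => // u s IHs; rewrite inE big_cons geq_min.
by case/predU1P => [->|/IHs ->]; rewrite ?leqnn ?orbT.
Qed.

Lemma k_independentS k (A B : {set T}) :
  A \subset B -> k_independent G k B -> k_independent G k A.
Proof.
move=> sAB /bigmax_leqP indB; apply/bigmax_leqP => v vA.
by rewrite (leq_trans _ (indB v _)) ?(subsetP sAB) // subset_leq_card ?setIS.
Qed.

Lemma card_degree_class_le k j :
  #|[set v | degree G v == j]| <= alpha_reg G k * chi G k.
Proof.
rewrite /chi; case: ex_minnP => c /existsP[f /forallP indf] _.
rewrite -sum1_card (partition_big f predT) //=.
have -> : alpha_reg G k * c = \sum_(i < c) alpha_reg G k.
  by rewrite sum_nat_const card_ord mulnC.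
apply: leq_sum => i _.
(* As part of a colour class [S] stays [k]-independent, and its degrees all equal [j], so
   [alpha_reg] bounds its size. *)
pose S := [set v | (degree G v == j) && (f v == i)].
rewrite (eq_bigl (mem S)) => [|v]; last by rewrite !inE.
rewrite sum1_card /alpha_reg.
apply: (@leq_bigmax_cond _ _ (fun A : {set T} => #|A|)); apply/andP; split.
  by apply: k_independentS (indf i); apply/subsetP => v; rewrite !inE => /andP[].
apply/forall_inP => u; rewrite inE => /andP[/eqP-> _].
by apply/forall_inP => v; rewrite inE => /andP[/eqP-> _].
Qed.

End GraphBounds.

Import Order.TTheory GRing.Theory Num.Theory.

Theorem proposition1p1 (k : nat) (T : finType) (G : sgraph T) :
  ((alpha_reg G k)%:R >=
     #|T|%:R /
       ((2%:R * avg_degree G - 2%:R * (min_degree G)%:R + 1) * (chi G k)%:R)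
     :> rat)%R.
Proof.
have [->|n_gt0] := posnP #|T|; first by rewrite mul0r.
have n_gt0Q : (0 < #|T|%:R :> rat)%R by rewrite ltr0n.
set D := (_ - _ + 1)%R.
have le_n : (#|T|%:R <= (alpha_reg G k)%:R * (D * (chi G k)%:R))%R.
  rewrite -(ler_pM2l n_gt0Q).
  have := sqr_card_le (@card_degree_class_le _ G k) (@min_degree_le _ G).
  rewrite -(ler_nat rat) natrX expr2 => /le_trans-> //.
  (* What remains is an equality: the weights [2 (deg v - delta) + 1] sum to [n D]. By
     [min_degree_le] the truncated differences are true ones. *)
  rewrite le_eqVlt; apply/orP; left; apply/eqP.
  rewrite -big_distrl natrM natr_sum.
  under eq_bigr do rewrite -addn1 -muln2 natrD natrM natrB ?min_degree_le //.
  rewrite big_split -mulr_suml sumrB -natr_sum !sumr_const -mulr_natr natrM.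
  rewrite /D /avg_degree -[(_ *+ #|T|)%R]mulr_natr /=.
  by field; rewrite gt_eqF.
(* A nonpositive denominator would make the right side of [le_n] nonpositive, although [n > 0]. *)
have D_gt0 : (0 < D * (chi G k)%:R)%R.
  rewrite ltNge; apply: contraL (lt_le_trans n_gt0Q le_n) => D_le0.
  by rewrite -leNgt mulr_ge0_le0.
by rewrite ler_pdivrMr.
Qed.
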